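(* Let $A\in\mathbb R^{n\times n}$ with $A\neq A^T$, $C\in\mathcal S_m$, $E\in\mathcal S_p$, $B\in\mathbb R^{m\times n}$, $D_1,D_2\in\mathbb R^{p\times m}$ with $D_1\ne D_2$, $f\in\mathbb R^n$, $g\in\mathbb R^m$, $h\in\mathbb R^p$ be such that the coefficient matrix of the double saddle point problem $$\begin{bmatrix} A & B^T & 0 \\ B & -C & D_1^T \\ 0 & D_2 & E \end{bmatrix}\begin{bmatrix} x \\ y \\ z \end{bmatrix}=\begin{bmatrix} f \\ g \\ h \end{bmatrix}$$ is nonsingular. Let $[\tilde x^T,\tilde y^T,\tilde z^T]^T$ with $\tilde x\in\mathbb R^n,\tilde y\in\mathbb R^m,\tilde z\in\mathbb R^p$ be an approximate solution of this system (i.e. any given vector), and let $\theta_1,\theta_2,\theta_4,\theta_5,\theta_6,\theta_7,\theta_8,\theta_9,\theta_{10}\ge0$ with $\theta_8,\theta_9,\theta_{10}\ne0$. Then the sparsity-preserving structured backward error satisfies $$\eta^{\mathbb S_3}_{\rm sps}(\tilde x,\tilde y,\tilde z)=\left\|\mathcal J^T(\mathcal J\mathcal J^T)^{-1}R\right\|_2,$$ where $R=[R_f^T,R_g^T,R_h^T]^T$, $R_f=f-A\tilde x-B^T\tilde y$, $R_g=g-B\tilde x+C\tilde y-D_1^T\tilde z$, $R_h=h-D_2\tilde y-E\tilde z$, and $\mathcal J=[\widetilde{\mathcal J}\;\;\mathcal I]\in\mathbb R^{(n+m+p)\times l}$, $l=n^2+\sigma+\tau+mn+2mp+n+m+p$,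 with $$\widetilde{\mathcal J}=\begin{bmatrix} \frac1{\theta_1}\mathcal M^n_{\tilde x}\Phi_A & \frac1{\theta_2}\mathcal N^n_{\tilde y}\Phi_B & 0 & 0 & 0 & 0 \\ 0 & \frac1{\theta_2}\mathcal M^m_{\tilde x}\Phi_B & -\frac1{\theta_4}\mathcal K_{\tilde y}\Phi_C\mathfrak D_{\mathcal S_m}^{-1} & \frac1{\theta_5}\mathcal N^m_{\tilde z}\Phi_{D_1} & 0 & 0 \\ 0 & 0 & 0 & 0 & \frac1{\theta_6}\mathcal M^p_{\tilde y}\Phi_{D_2} & \frac1{\theta_7}\mathcal K_{\tilde z}\Phi_E\mathfrak D_{\mathcal S_p}^{-1} \end{bmatrix},$$ $$\mathcal I=\begin{bmatrix} -\frac1{\theta_8}I_n & 0 & 0 \\ 0 & -\frac1{\theta_9}I_m & 0 \\ 0 & 0 & -\frac1{\theta_{10}}I_p \end{bmatrix}.$$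
   Context: Notation. $\mathcal S_k$ is the set of real symmetric $k\times k$ matrices; $\sigma=\frac{m(m+1)}2$, $\tau=\frac{p(p+1)}2$. $\odot$ is the Hadamard (entrywise) product. For a real matrix $X=[x_{ij}]$, $\Theta_X$ is the matrix of the same size whose $(i,j)$ entry is $1$ if $x_{ij}\ne0$ and $0$ if $x_{ij}=0$. $\mathrm{vec}(X)$ stacks the columns of $X$. For $X\in\mathcal S_k$, $\mathrm{vec}_{\mathcal S}(X)\in\mathbb R^{k(k+1)/2}$ stacks the lower-triangular parts of the columns: $(x_{11},x_{21},\dots,x_{k1},x_{22},x_{32},\dots,x_{k2},\dots,x_{kk})^T$. $\Phi_X=\mathrm{diag}(\mathrm{vec}_{\mathcal S}(\Theta_X))$ for $X\in\{C,E\}$ and $\Phi_X=\mathrm{diag}(\mathrm{vec}(\Theta_X))$ for $X\in\{A,B,D_1,D_2\}$. $\mathfrak D_{\mathcal S_k}$ is the diagonal matrix of size $\frac{k(k+1)}2$ whose diagonal entry is $1$ at the positions in $\mathrm{vec}_{\mathcal S}$ of the diagonal entries $x_{ii}$ (positions $\frac{(2k-(i-2))(i-1)}2+1$, $i=1,\dots,k$) and $\sqrt2$ at all other positions. For $x\in\mathbb R^k$, $\mathcal K_x=[K_x^1\;K_x^2\;\cdots\;K_x^k]\in\mathbb R^{k\times k(k+1)/2}$, where $K_x^i\in\mathbb R^{k\times(k-i+1)}$ has first $i-1$ rows zero, $i$-th row equal to $(x_i,x_{i+1},\dots,x_k)$, and, for $r=i+1,\dots,k$, $r$-th row having the single nonzero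 entry $x_i$ in column $r-i+1$. For $x\in\mathbb R^{b}$, $\mathcal M^{a}_x=[x_1I_a\;x_2I_a\;\cdots\;x_bI_a]\in\mathbb R^{a\times ab}$. For $y\in\mathbb R^{a}$, $\mathcal N^{b}_y\in\mathbb R^{b\times ab}$ is the block diagonal matrix with $b$ diagonal blocks each equal to the row $y^T$. Conventions on weights. The $\theta_i$ are nonnegative reals, with $\frac1{\theta_i}:=0$ if $\theta_i=0$; $\theta_i=0$ means that the corresponding block is not perturbed (its perturbation is required to be zero). Structured backward error. $\mathbb S_3$ is the set of tuples $(\Delta A,\Delta B,\Delta C,\Delta D_1,\Delta D_2,\Delta E,\Delta f,\Delta g,\Delta h)$ with $\Delta A\in\mathbb R^{n\times n}$, $\Delta B\in\mathbb R^{m\times n}$, $\Delta C\in\mathcal S_m$, $\Delta D_1,\Delta D_2\in\mathbb R^{p\times m}$, $\Delta E\in\mathcal S_p$, $\Delta f\in\mathbb R^n$, $\Delta g\in\mathbb R^m$, $\Delta h\in\mathbb R^p$ such that $$\begin{bmatrix} A+\Delta A & (B+\Delta B)^T & 0 \\ B+\Delta B & -(C+\Delta C) & (D_1+\Delta D_1)^T \\ 0 & D_2+\Delta D_2 & E+\Delta E \end{bmatrix}\begin{bmatrix} \tilde x \\ \tilde y \\ \tilde z \end{bmatrix}=\begin{bmatrix} f+\Delta f \\ g+\Delta g \\ h+\Delta h \end{bmatrix}.$$ $\eta^{\mathbb S_3}_{\rm sps}(\tilde x,\tilde y,\tilde z)$ is the minimum of $$\left(\theta_1^2\|\Delta A\|_F^2+\theta_2^2\|\Delta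 B\|_F^2+\theta_4^2\|\Delta C\|_F^2+\theta_5^2\|\Delta D_1\|_F^2+\theta_6^2\|\Delta D_2\|_F^2+\theta_7^2\|\Delta E\|_F^2+\theta_8^2\|\Delta f\|_2^2+\theta_9^2\|\Delta g\|_2^2+\theta_{10}^2\|\Delta h\|_2^2\right)^{1/2}$$ over all tuples in $\mathbb S_3$ whose matrix perturbations preserve the sparsity pattern, i.e. $\Delta X=\Delta X\odot\Theta_X$ for $X\in\{A,B,C,D_1,D_2,E\}$. *)

(* Defs.v *)
From HB Require Import structures.
From mathcomp Require Import all_boot all_order all_algebra.
From mathcomp Require Import boolp classical_sets reals.

Set Implicit Arguments.
Unset Strict Implicit.
Unset Printing Implicit Defensive.

Import Order.TTheory GRing.Theory Num.Theory.
Local Open Scope ring_scope.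

(* Vectors are column matrices.  [fnorm] is the Frobenius norm, hence the
   Euclidean norm on 'cV_k (the canonical norm `|_| on matrices in
   MathComp-Analysis is the max norm instead). *)
Definition fnorm (R : realType) (a b : nat) (X : 'M[R]_(a, b)) : R :=
  Num.sqrt (\sum_i \sum_j X i j ^+ 2).

Definition hadamard (R : realType) (a b : nat) (X Y : 'M[R]_(a, b)) :
  'M[R]_(a, b) := map2_mx *%R X Y.

Definition Theta (R : realType) (a b : nat) (X : 'M[R]_(a, b)) :
  'M[R]_(a, b) := \matrix_(i, j) (X i j != 0)%:R.

(* Column stacking; MathComp's [mxvec] would stack rows.  The dimension
   \sum_(j < b) a is a * b (see [dim_vec]). *)
Definition vec (R : realType) (a b : nat) (X : 'M[R]_(a, b)) :
  'cV[R]_(\sum_(j < b) a) := \mxcol_(j < b) col j X.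

(* The index j + r, for a row offset r below the diagonal entry of column j. *)
Lemma low_subproof (k : nat) (j : 'I_k) (r : 'I_(k - j)) : (j + r < k)%N.
Proof. by rewrite -ltn_subRL. Qed.

Definition low (k : nat) (j : 'I_k) (r : 'I_(k - j)) : 'I_k :=
  Ordinal (low_subproof r).

(* Half-vectorization: block j is (x_jj, x_(j+1)j, ..., x_kj)^T.  The dimension
   \sum_(j < k) (k - j) is k (k + 1) / 2 (see [dim_vecS]). *)
Definition vecS (R : realType) (k : nat) (X : 'M[R]_k) :
  'cV[R]_(\sum_(j < k) (k - j)) :=
  \mxcol_(j < k) \col_(r < k - j) X (low r) j.

Lemma dim_vec (a b : nat) : (\sum_(j < b) a = a * b)%N.
Proof. by rewrite sum_nat_const card_ord mulnC. Qed.

Lemma dim_vecS (k : nat) : (\sum_(j < k) (k - j) = (k * k.+1) %/ 2)%N.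
Proof.
have -> : (\sum_(j < k) (k - j) = \sum_(j < k) j.+1)%N.
  rewrite [RHS](reindex_inj rev_ord_inj) /=.
  by apply: eq_bigr => j _; rewrite -subSn // subSS.
rewrite mulnC divn2 -[k in RHS]/(k.+1.-1) -bin2 -bin2_sum big_mkord.
by rewrite big_ord_recl add0n.
Qed.

Definition Phi (R : realType) (a b : nat) (X : 'M[R]_(a, b)) :
  'M[R]_(\sum_(j < b) a) := diag_mx (vec (Theta X))^T.

Definition PhiS (R : realType) (k : nat) (X : 'M[R]_k) :
  'M[R]_(\sum_(j < k) (k - j)) := diag_mx (vecS (Theta X))^T.

(* Offset r = 0 in block j is the position of the diagonal entry x_jj. *)
Definition frakD (R : realType) (k : nat) : 'M[R]_(\sum_(j < k) (k - j)) :=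
  diag_mx (\mxrow_(j < k) \row_(r < k - j)
    (if r == 0%N :> nat then 1 else Num.sqrt 2)).

Definition Kblock (R : realType) (k : nat) (x : 'cV[R]_k) (i : 'I_k) :
  'M[R]_(k, k - i) :=
  \matrix_(r < k, c < k - i)
    (if (r < i)%N then 0
     else if r == i then x (low c) 0
     else if c == (r - i)%N :> nat then x i 0 else 0).

Definition Kmx (R : realType) (k : nat) (x : 'cV[R]_k) :
  'M[R]_(k, \sum_(i < k) (k - i)) := \mxrow_(i < k) Kblock x i.

Definition Mmx (R : realType) (a b : nat) (x : 'cV[R]_b) :
  'M[R]_(a, \sum_(j < b) a) := \mxrow_(j < b) (x j 0)%:M.

(* diag(y^T, ..., y^T), with b diagonal blocks: the j-th block column has y^T
   as its j-th row.  ([\mxdiag] would give the row dimension the type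
   \sum_(j < b) 1 instead of b.) *)
Definition Nmx (R : realType) (a b : nat) (y : 'cV[R]_a) :
  'M[R]_(b, \sum_(j < b) a) :=
  \mxrow_(j < b) \matrix_(i < b, c < a) (if i == j then y c 0 else 0).

(* The data (A, B, C, D1, D2, E, f, g, h) of a double saddle point problem;
   tuples of perturbations (Delta A, ..., Delta h) have the same type. *)
Record dsp (R : realType) (n m p : nat) := Dsp {
  bA : 'M[R]_n;
  bB : 'M[R]_(m, n);
  bC : 'M[R]_m;
  bD1 : 'M[R]_(p, m);
  bD2 : 'M[R]_(p, m);
  bE : 'M[R]_p;
  bf : 'cV[R]_n;
  bg : 'cV[R]_m;
  bh : 'cV[R]_p }.

Record weights (R : realType) := Weights {
  th1 : R; th2 : R; th4 : R; th5 : R; th6 : R; th7 : R;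
  th8 : R; th9 : R; th10 : R }.

Definition dsp_mx (R : realType) (n m p : nat) (P : dsp R n m p) :
  'M[R]_(n + (m + p)) :=
  col_mx (row_mx (bA P) (row_mx (bB P)^T 0))
 (col_mx (row_mx (bB P) (row_mx (- bC P) (bD1 P)^T))
         (row_mx 0 (row_mx (bD2 P) (bE P)))).

Definition dsp_rhs (R : realType) (n m p : nat) (P : dsp R n m p) :
  'cV[R]_(n + (m + p)) := col_mx (bf P) (col_mx (bg P) (bh P)).

Definition dsp_add (R : realType) (n m p : nat) (P Q : dsp R n m p) :
  dsp R n m p :=
  Dsp (bA P + bA Q) (bB P + bB Q) (bC P + bC Q) (bD1 P + bD1 Q)
      (bD2 P + bD2 Q) (bE P + bE Q) (bf P + bf Q) (bg P + bg Q) (bh P + bh Q).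

Definition S3 (R : realType) (n m p : nat) (P : dsp R n m p)
    (x : 'cV[R]_n) (y : 'cV[R]_m) (z : 'cV[R]_p) : set (dsp R n m p) :=
  fun d => [/\ (bC d)^T = bC d, (bE d)^T = bE d &
    dsp_mx (dsp_add P d) *m col_mx x (col_mx y z) = dsp_rhs (dsp_add P d)].

Definition sparsity_preserving (R : realType) (n m p : nat)
    (P : dsp R n m p) : set (dsp R n m p) :=
  fun d => [/\ bA d = hadamard (bA d) (Theta (bA P)),
               bB d = hadamard (bB d) (Theta (bB P)) &
               bC d = hadamard (bC d) (Theta (bC P))] /\
           [/\ bD1 d = hadamard (bD1 d) (Theta (bD1 P)),
               bD2 d = hadamard (bD2 d) (Theta (bD2 P)) &
               bE d = hadamard (bE d) (Theta (bE P))].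

(* A zero weight means that the corresponding block is not perturbed. *)
Definition zero_weights_unperturbed (R : realType) (n m p : nat)
    (w : weights R) : set (dsp R n m p) :=
  fun d => [/\ th1 w = 0 -> bA d = 0,
               th2 w = 0 -> bB d = 0 &
               th4 w = 0 -> bC d = 0] /\
           [/\ th5 w = 0 -> bD1 d = 0,
               th6 w = 0 -> bD2 d = 0 &
               th7 w = 0 -> bE d = 0] /\
           [/\ th8 w = 0 -> bf d = 0,
               th9 w = 0 -> bg d = 0 &
               th10 w = 0 -> bh d = 0].

Definition cost (R : realType) (n m p : nat) (w : weights R)
    (d : dsp R n m p) : R :=
  Num.sqrt (th1 w ^+ 2 * fnorm (bA d) ^+ 2 + th2 w ^+ 2 * fnorm (bB d) ^+ 2
          + th4 w ^+ 2 * fnorm (bC d) ^+ 2 + th5 w ^+ 2 * fnorm (bD1 d) ^+ 2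
          + th6 w ^+ 2 * fnorm (bD2 d) ^+ 2 + th7 w ^+ 2 * fnorm (bE d) ^+ 2
          + th8 w ^+ 2 * fnorm (bf d) ^+ 2 + th9 w ^+ 2 * fnorm (bg d) ^+ 2
          + th10 w ^+ 2 * fnorm (bh d) ^+ 2).

Local Open Scope classical_set_scope.

Definition sps_costs (R : realType) (n m p : nat) (w : weights R)
    (P : dsp R n m p) (x : 'cV[R]_n) (y : 'cV[R]_m) (z : 'cV[R]_p) : set R :=
  cost w @` (S3 P x y z `&` sparsity_preserving P
             `&` zero_weights_unperturbed w).

(* The structured backward error.  The set of costs is bounded below by 0, so
   [inf] is its minimum exactly when it belongs to the set; [inf] is 0 by
   convention on the empty set. *)
Definition eta_sps (R : realType) (n m p : nat) (w : weights R)
    (P : dsp R n m p) (x : 'cV[R]_n) (y : 'cV[R]_m) (z : 'cV[R]_p) : R :=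
  inf (sps_costs w P x y z).

Local Close Scope classical_set_scope.

Definition residual (R : realType) (n m p : nat) (P : dsp R n m p)
    (x : 'cV[R]_n) (y : 'cV[R]_m) (z : 'cV[R]_p) : 'cV[R]_(n + (m + p)) :=
  col_mx (bf P - bA P *m x - (bB P)^T *m y)
 (col_mx (bg P - bB P *m x + bC P *m y - (bD1 P)^T *m z)
         (bh P - bD2 P *m y - bE P *m z)).

(* The column dimension is n^2 + mn + sigma + mp + mp + tau.
   The convention 1 / 0 := 0 for the weights is MathComp's 0^-1 = 0. *)
Definition Jtilde (R : realType) (n m p : nat) (w : weights R)
    (P : dsp R n m p) (x : 'cV[R]_n) (y : 'cV[R]_m) (z : 'cV[R]_p) :
  'M[R]_(n + (m + p), \sum_(j < n) n + (\sum_(j < n) m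
    + (\sum_(j < m) (m - j) + (\sum_(j < m) p
    + (\sum_(j < m) p + \sum_(j < p) (p - j)))))) :=
  col_mx
   (row_mx ((th1 w)^-1 *: (Mmx n x *m Phi (bA P)))
   (row_mx ((th2 w)^-1 *: (Nmx n y *m Phi (bB P)))
   (row_mx 0 (row_mx 0 (row_mx 0 0)))))
 (col_mx
   (row_mx 0
   (row_mx ((th2 w)^-1 *: (Mmx m x *m Phi (bB P)))
   (row_mx (- (th4 w)^-1 *: (Kmx y *m PhiS (bC P) *m invmx (frakD R m)))
   (row_mx ((th5 w)^-1 *: (Nmx m z *m Phi (bD1 P)))
   (row_mx 0 0)))))
   (row_mx 0 (row_mx 0 (row_mx 0 (row_mx 0
   (row_mx ((th6 w)^-1 *: (Mmx p y *m Phi (bD2 P)))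
           ((th7 w)^-1 *: (Kmx z *m PhiS (bE P) *m invmx (frakD R p))))))))).

Definition calI (R : realType) (n m p : nat) (w : weights R) :
  'M[R]_(n + (m + p)) :=
  col_mx (row_mx (- (th8 w)^-1)%:M (row_mx 0 0))
 (col_mx (row_mx 0 (row_mx (- (th9 w)^-1)%:M 0))
         (row_mx 0 (row_mx 0 (- (th10 w)^-1)%:M))).

Definition calJ (R : realType) (n m p : nat) (w : weights R)
    (P : dsp R n m p) (x : 'cV[R]_n) (y : 'cV[R]_m) (z : 'cV[R]_p) :=
  row_mx (Jtilde w P x y z) (calI n m p w).

(* Main.v *)
(* Stacking the weighted entries t_i * X of a perturbation into a vector
   [dsp_vec], with each half-vectorized symmetric block scaled by [frakD], turns
   the cost into a Euclidean norm and, for admissible perturbations, the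
   perturbed system into the underdetermined linear system J u = R.  The block
   [calI] of J is invertible, so J has full row rank and J^T (J J^T)^-1 R is the
   least norm solution.  It lies in the range of J^T, whose elements vanish off
   the sparsity pattern and on the blocks of zero weight; hence it is the vector
   of an admissible perturbation, and the least norm is attained. *)
Require Import Defs.
From mathcomp Require Import all_boot all_order all_algebra.
From mathcomp Require Import boolp classical_sets reals.
From mathcomp Require Import ring.

Set Implicit Arguments.
Unset Strict Implicit.
Unset Printing Implicit Defensive.

Import Order.TTheory GRing.Theory Num.Theory.
Local Open Scope ring_scope.

(** * Frobenius norm and least norm solutions *)

Lemma fnorm_sqr (R : realType) (a b : nat) (X : 'M[R]_(a, b)) :
  fnorm X ^+ 2 = \tr (X^T *m X).
Proof.
rewrite sqr_sqrtr; last by do 2!apply: sumr_ge0 => ? _; exact: sqr_ge0.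
rewrite exchange_big; apply: eq_bigr => j _; rewrite mxE.
by apply: eq_bigr => i _; rewrite mxE expr2.
Qed.

Lemma fnorm_ge0 (R : realType) (a b : nat) (X : 'M[R]_(a, b)) : 0 <= fnorm X.
Proof. exact: sqrtr_ge0. Qed.

Lemma fnorm_sqr_eq0 (R : realType) (a b : nat) (X : 'M[R]_(a, b)) :
  fnorm X ^+ 2 = 0 -> X = 0.
Proof.
rewrite sqr_sqrtr; last by do 2!apply: sumr_ge0 => ? _; exact: sqr_ge0.
move/eqP; rewrite psumr_eq0; last first.
  by move=> i _; apply: sumr_ge0 => ? _; exact: sqr_ge0.
move=> /allP X0; apply/matrixP => i j; rewrite mxE; apply/eqP.
have := X0 i (mem_index_enum _); rewrite /= psumr_eq0; last first.
  by move=> ? _; exact: sqr_ge0.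
by move=> /allP/(_ j (mem_index_enum _)); rewrite /= sqrf_eq0.
Qed.

Lemma fnorm_sqrZ (R : realType) (a b : nat) (c : R) (X : 'M[R]_(a, b)) :
  fnorm (c *: X) ^+ 2 = c ^+ 2 * fnorm X ^+ 2.
Proof.
by rewrite !fnorm_sqr [(c *: X)^T]linearZ /= -scalemxAl -scalemxAr scalerA
  linearZ expr2.
Qed.

Lemma fnorm_sqr_col_mx (R : realType) (a b c : nat)
    (X : 'M[R]_(a, c)) (Y : 'M[R]_(b, c)) :
  fnorm (col_mx X Y) ^+ 2 = fnorm X ^+ 2 + fnorm Y ^+ 2.
Proof. by rewrite !fnorm_sqr tr_col_mx mul_row_col mxtraceD. Qed.

(** If u J J^T = 0 then uJ has zero norm, since its square is the trace of u J J^T u^T; the right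
    inverse [K] then gives u = 0. *)
Lemma gram_unitmx (R : realType) (a b : nat) (J : 'M[R]_(a, b))
    (K : 'M[R]_(b, a)) : J *m K = 1%:M -> J *m J^T \in unitmx.
Proof.
move=> JK; rewrite -row_free_unit; apply/inj_row_free => u uJJ0.
have uJ0 : (u *m J)^T = 0.
  apply: fnorm_sqr_eq0; rewrite fnorm_sqr trmxK trmx_mul -mulmxA (mulmxA J).
  by rewrite mulmxA uJJ0 mul0mx mxtrace0.
by rewrite -[u]mulmx1 -JK mulmxA -[u *m J]trmxK uJ0 trmx0 mul0mx.
Qed.

(* The minimal norm solution [v] is in the range of [J^T], hence orthogonal to
   [u - v], which is in the kernel of [J]. *)
Lemma fnorm_min_norm (R : realType) (a b : nat) (J : 'M[R]_(a, b))
    (r : 'cV[R]_a) (u : 'cV[R]_b) :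
  J *m J^T \in unitmx -> J *m u = r ->
  fnorm (J^T *m invmx (J *m J^T) *m r) <= fnorm u.
Proof.
move=> Junit Jur; set v := _ *m r.
have Jv : J *m v = r by rewrite /v !mulmxA mulmxV // mul1mx.
have vtE : v^T = (invmx (J *m J^T) *m r)^T *m J.
  by rewrite /v -mulmxA trmx_mul trmxK.
have JD : J *m (u - v) = 0 by rewrite mulmxBr Jur Jv subrr.
have vD : v^T *m (u - v) = 0 by rewrite vtE -mulmxA JD mulmx0.
have Dv : (u - v)^T *m v = 0 by rewrite -[RHS]trmx0 -vD trmx_mul trmxK.
rewrite -(@ler_pXn2r _ 2) ?nnegrE ?fnorm_ge0 //.
have -> : fnorm u ^+ 2 = fnorm v ^+ 2 + fnorm (u - v) ^+ 2.
  rewrite -{1}[u](subrK v) !fnorm_sqr; move: (u - v) vD Dv => w vw wv.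
  rewrite [(w + v)^T]linearD /= mulmxDl !mulmxDr vw wv addr0 add0r.
  by rewrite mxtraceD addrC.
by rewrite lerDl sqr_ge0.
Qed.

(** * Sparsity masks and column stacking *)

Lemma hadamardZ (R : realType) (a b : nat) (c : R) (X A : 'M[R]_(a, b)) :
  hadamard (c *: X) A = c *: hadamard X A.
Proof. by apply/matrixP => i j; rewrite !mxE mulrA. Qed.

(** Scaling a perturbation by t^-2 and weighting it by t leaves the factor t^-1 of [calJ]; the case
    t = 0 relies on 0^-1 = 0. *)
Lemma mulr_inv_sqr (R : fieldType) (t : R) : t * t ^- 2 = t^-1.
Proof.
have [->|t0] := eqVneq t 0; first by rewrite mul0r invr0.
by rewrite -exprVn expr2 mulrA divff // mul1r.
Qed.

Lemma hadamard_ThetaK (R : realType) (a b : nat) (X A : 'M[R]_(a, b)) :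
  hadamard (hadamard X (Theta A)) (Theta A) = hadamard X (Theta A).
Proof.
by apply/matrixP => i j; rewrite !mxE; case: eqP; rewrite ?mulr0 ?mulr1.
Qed.

Lemma vecZ (R : realType) (a b : nat) (c : R) (X : 'M[R]_(a, b)) :
  vec (c *: X) = c *: vec X.
Proof. by apply/matrixP => s j; rewrite !mxE. Qed.

Lemma vec_surj (R : realType) (a b : nat) (v : 'cV[R]_(\sum_(j < b) a)) :
  exists X : 'M[R]_(a, b), vec X = v.
Proof.
exists (\matrix_(i, j) submxcol v j i 0).
apply/mxcolP => j; rewrite mxcolK.
by apply/colP => i; rewrite !mxE.
Qed.

Lemma vec_hadamard (R : realType) (a b : nat) (X A : 'M[R]_(a, b)) :
  vec (hadamard X (Theta A)) = Phi A *m vec X.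
Proof. by apply/matrixP => s j; rewrite mul_diag_mx !mxE mulrC. Qed.

Lemma mul_Mmx_vec (R : realType) (a b : nat) (x : 'cV[R]_b)
    (X : 'M[R]_(a, b)) : Mmx a x *m vec X = X *m x.
Proof.
rewrite mul_mxrow_mxcol; apply/colP => i; rewrite summxE mxE.
by apply: eq_bigr => j _; rewrite mul_scalar_mx !mxE mulrC.
Qed.

Lemma mul_Nmx_vec (R : realType) (a b : nat) (y : 'cV[R]_a)
    (X : 'M[R]_(a, b)) : Nmx b y *m vec X = X^T *m y.
Proof.
rewrite mul_mxrow_mxcol; apply/colP => i; rewrite summxE mxE.
rewrite (bigD1 i) //= big1 ?addr0 => [|j /negPf ji].
  by rewrite mxE; apply: eq_bigr => c _; rewrite !mxE eqxx mulrC.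
by rewrite mxE big1 // => c _; rewrite !mxE eq_sym ji mul0r.
Qed.

Lemma fnorm_vec (R : realType) (a b : nat) (X : 'M[R]_(a, b)) :
  fnorm (vec X) ^+ 2 = fnorm X ^+ 2.
Proof.
rewrite !fnorm_sqr tr_mxcol mul_mxrow_mxcol raddf_sum /=.
apply: eq_bigr => j _; rewrite !trace_mx11 !mxE.
by apply: eq_bigr => i _; rewrite !mxE.
Qed.

(** * Half-vectorization of symmetric matrices *)

Lemma big_low (R : realType) (k : nat) (j : 'I_k) (F : 'I_k -> R) :
  \sum_(r < k - j) F (low r) = \sum_(i < k | (j <= i)%N) F i.
Proof.
have kj : (0 < k - j)%N by rewrite subn_gt0.
rewrite [RHS](reindex (@low k j)) /=; last first.
  (* The inverse of [low] is i - j. [kj] only supplies the default that [insubd] requires; it is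
     never returned, since i - j < k - j. *)
  exists (fun i : 'I_k => insubd (Ordinal kj) (i - j)%N) => [r _|i].
    by apply: val_inj; rewrite val_insubd /= addKn ltn_ord.
  rewrite inE => ji; apply: val_inj; rewrite /= val_insubd.
  by rewrite ltn_sub2r // subnKC.
by apply: eq_bigl => r; rewrite leq_addr.
Qed.

Lemma vecSZ (R : realType) (k : nat) (c : R) (X : 'M[R]_k) :
  vecS (c *: X) = c *: vecS X.
Proof. by apply/matrixP => s j; rewrite !mxE. Qed.

Lemma low_inj (k : nat) (j : 'I_k) : injective (@low k j).
Proof. by move=> r s /(congr1 val) /= /addnI rs; exact: val_inj. Qed.

Lemma vecS_surj (R : realType) (k : nat)
    (v : 'cV[R]_(\sum_(j < k) (k - j))) :
  exists2 X : 'M[R]_k, X^T = X & vecS X = v.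
Proof.
(* [L] is the lower triangular matrix with half-vectorization [v]. *)
pose L : 'M[R]_k :=
  \matrix_(i, j) \sum_(r < k - j | low r == i) submxcol v j r 0.
exists (\matrix_(i, j) if (j <= i)%N then L i j else L j i).
  apply/matrixP => i j; rewrite !mxE.
  by case: (ltngtP i j) => //= /val_inj ->.
apply/mxcolP => j; rewrite mxcolK; apply/colP => r.
rewrite 2!mxE leq_addr mxE (big_pred1 r) // => s /=.
by rewrite (inj_eq (@low_inj _ _)).
Qed.

Lemma vecS_hadamard (R : realType) (k : nat) (X A : 'M[R]_k) :
  vecS (hadamard X (Theta A)) = PhiS A *m vecS X.
Proof. by apply/matrixP => s j; rewrite mul_diag_mx !mxE mulrC. Qed.

Lemma tr_hadamard_Theta (R : realType) (k : nat) (X A : 'M[R]_k) :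
  X^T = X -> A^T = A -> (hadamard X (Theta A))^T = hadamard X (Theta A).
Proof.
move=> Xs As; apply/matrixP => i j; rewrite !mxE.
by rewrite -{1}Xs -{1}As !mxE.
Qed.

(** In row r, block i = r yields the terms x_l X_lr with l >= r, each block i < r yields the single
    term x_i X_ri, and the blocks i > r vanish; symmetry turns X_lr into X_rl. *)
Lemma mul_Kmx_vecS (R : realType) (k : nat) (x : 'cV[R]_k) (X : 'M[R]_k) :
  X^T = X -> Kmx x *m vecS X = X *m x.
Proof.
move=> Xs; have XC i j : X i j = X j i by rewrite -{1}Xs mxE.
rewrite mul_mxrow_mxcol; apply/colP => r; rewrite summxE mxE.
(* [G] is the summand of block i indexed by the actual row l = i + c instead of the offset c. *)
pose G (i l : 'I_k) := (if (r < i)%N then 0 else if r == i then x l 0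
  else if l == r then x i 0 else 0) * X l i.
transitivity (\sum_(i < k) \sum_(l < k | (i <= l)%N) G i l).
  apply: eq_bigr => i _; rewrite -big_low mxE.
  apply: eq_bigr => c _; rewrite !mxE /G; case: ltnP => // ir.
  have -> // : (low c == r) = (c == (r - i)%N :> nat).
  by rewrite -(inj_eq val_inj) /= -[RHS](eqn_add2l i) subnKC.
rewrite (bigID (fun i : 'I_k => (r <= i)%N)) /=.
rewrite [RHS](bigID (fun j : 'I_k => (r <= j)%N)) /=; congr (_ + _).
  rewrite (bigD1 r) //= [X in _ + X]big1 ?addr0 => [|i /andP[ri nir]].
    by apply: eq_bigr => l _; rewrite /G ltnn eqxx mulrC XC.
  by rewrite big1 // => l _; rewrite /G ltn_neqAle eq_sym nir ri mul0r.
apply: eq_bigr => i; rewrite -ltnNge => ir.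
have ri : (r == i) = false by apply/eqP => ri; rewrite ri ltnn in ir.
rewrite (bigD1 r) 1?ltnW //= big1 ?addr0 => [|l /andP[_ /negPf lr]].
  by rewrite /G ltnNge ltnW // ri eqxx mulrC.
by rewrite /G ltnNge ltnW // ri lr mul0r.
Qed.

Lemma frakD_unit (R : realType) (k : nat) : frakD R k \in unitmx.
Proof.
rewrite unitmxE det_diag unitfE; apply/prodf_neq0 => s _; rewrite !mxE.
by case: ifP => _; rewrite ?oner_eq0 // sqrtr_eq0 -ltNge ltr0n.
Qed.

(* The off-diagonal entries of a symmetric matrix occur twice in its Frobenius
   norm but once in [vecS]: hence the factors [sqrt 2] of [frakD]. *)
Lemma fnorm_frakD_vecS (R : realType) (k : nat) (X : 'M[R]_k) :
  X^T = X -> fnorm (frakD R k *m vecS X) ^+ 2 = fnorm X ^+ 2.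
Proof.
move=> Xs; have XC i j : X i j = X j i by rewrite -{1}Xs mxE.
have -> : frakD R k *m vecS X = \mxcol_(j < k) \col_(r < k - j)
    ((if r == 0%N :> nat then 1 else Num.sqrt 2) * X (low r) j).
  by apply/matrixP => s t; rewrite mul_diag_mx !mxE.
rewrite !fnorm_sqr tr_mxcol mul_mxrow_mxcol raddf_sum /=.
(* [S] collects the squares strictly below the diagonal; both sides equal the diagonal squares plus
   2S, by symmetry on the right. *)
pose S := \sum_(j < k) \sum_(i < k | (j < i)%N) X i j ^+ 2.
transitivity (\sum_(j < k) X j j ^+ 2 + S + S); last first.
  transitivity (\sum_j \sum_i X i j ^+ 2); last first.
    by apply: eq_bigr => j _; rewrite mxE; apply: eq_bigr => i _; rewrite mxE.
  have SE : S = \sum_(j < k) \sum_(i < k | (i < j)%N) X i j ^+ 2.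
    rewrite /S (exchange_big_dep predT) //=; apply: eq_bigr => i _.
    by apply: eq_bigr => j _; rewrite XC.
  rewrite {2}SE -!big_split /=; apply: eq_bigr => j _.
  rewrite [RHS](bigD1 j) //= -addrA; congr (_ + _).
  rewrite [RHS](bigID (fun i : 'I_k => (j < i)%N)) /=; congr (_ + _).
    apply: eq_bigl => i. by case: eqP => [->|]; rewrite ?ltnn.
  by apply: eq_bigl => i; rewrite -leqNgt ltn_neqAle.
rewrite -addrA -big_split -big_split /=; apply: eq_bigr => j _.
rewrite trace_mx11 mxE.
(* Squaring turns the factor sqrt 2 into 2, and offset 0 becomes the condition i = j. *)
pose G (i : 'I_k) := (if i == j then 1 else 2) * X i j ^+ 2.
rewrite (eq_bigr (fun r => G (low r))) => [|r _]; last first.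
  rewrite /G.
  have -> : (low r == j) = (r == 0%N :> nat).
    by rewrite -(inj_eq val_inj) /= -[X in _ == X]addn0 eqn_add2l.
  rewrite !mxE.
  by case: ifP => _; rewrite -expr2 exprMn ?expr1n // sqr_sqrtr // ler0n.
rewrite big_low (bigD1 j) //= {1}/G eqxx mul1r; congr (_ + _).
rewrite -big_split /=; apply: eq_big => [i|i /andP[_ /negPf ij]].
  by rewrite ltn_neqAle eq_sym andbC.
by rewrite /G ij mulr_natl mulr2n.
Qed.

(** * Single blocks of J and of its transpose *)

(** The right-hand side is the shape of an unsymmetric block in the range of J^T, so that block
    comes from an admissible perturbation. For t = 0 both sides vanish. *)
Lemma vec_range (R : realType) (a b : nat) (t : R) (A : 'M[R]_(a, b))
    (q : 'cV[R]_(\sum_(j < b) a)) :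
  exists X : 'M[R]_(a, b), [/\ X = hadamard X (Theta A), t = 0 -> X = 0 &
    t *: vec X = t^-1 *: (Phi A *m q)].
Proof.
have [X0 <-] := vec_surj q.
exists (t ^- 2 *: hadamard X0 (Theta A)); split.
- by rewrite hadamardZ hadamard_ThetaK.
- by move=> ->; rewrite expr0n invr0 scale0r.
- by rewrite vecZ scalerA vec_hadamard mulr_inv_sqr.
Qed.

Lemma vecS_range (R : realType) (k : nat) (t : R) (A : 'M[R]_k)
    (q : 'cV[R]_(\sum_(j < k) (k - j))) : A^T = A ->
  exists X : 'M[R]_k, [/\ X^T = X, X = hadamard X (Theta A), t = 0 -> X = 0 &
    t *: (frakD R k *m vecS X)
      = t^-1 *: (invmx (frakD R k) *m (PhiS A *m q))].
Proof.
move=> As; set D := frakD R k; have Du : D \in unitmx := frakD_unit R k.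
(* One inverse of [D] cancels the [D] in front of [vecS X], the other is the one required on the
   right; they move past [PhiS A] because diagonal matrices commute. *)
have [X0 X0s X0q] := vecS_surj (invmx D *m (invmx D *m q)).
exists (t ^- 2 *: hadamard X0 (Theta A)); split.
- by rewrite linearZ /= tr_hadamard_Theta.
- by rewrite hadamardZ hadamard_ThetaK.
- by move=> ->; rewrite expr0n invr0 scale0r.
- rewrite vecSZ vecS_hadamard X0q -scalemxAr scalerA mulr_inv_sqr.
  have PD : PhiS A *m D = D *m PhiS A by exact: diag_mxC.
  have PDV v : PhiS A *m (invmx D *m v) = invmx D *m (PhiS A *m v).
    by apply: (canRL (mulKmx Du)); rewrite mulmxA -PD -mulmxA mulKVmx.
  by rewrite !PDV mulKVmx.
Qed.

(* If [t = 0] then [X = 0], so that the convention 1 / 0 = 0 is harmless. *)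
Lemma mul_block_vec (R : realType) (a b c : nat) (t : R)
    (M : 'M[R]_(c, \sum_(j < b) a)) (A X : 'M[R]_(a, b)) :
  X = hadamard X (Theta A) -> (t = 0 -> X = 0) ->
  (t^-1 *: (M *m Phi A)) *m (t *: vec X) = M *m vec X.
Proof.
move=> XA X0; rewrite -scalemxAl -scalemxAr scalerA -mulmxA -vec_hadamard -XA.
have [t0|t0] := eqVneq t 0; last by rewrite mulVf // scale1r.
by rewrite X0 // -[0](scale0r 0) vecZ scale0r mulmx0 scaler0.
Qed.

Lemma mul_block_vecS (R : realType) (k c : nat) (t : R)
    (M : 'M[R]_(c, \sum_(j < k) (k - j))) (A X : 'M[R]_k) :
  X = hadamard X (Theta A) -> (t = 0 -> X = 0) ->
  (t^-1 *: (M *m PhiS A *m invmx (frakD R k))) *m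
    (t *: (frakD R k *m vecS X)) = M *m vecS X.
Proof.
move=> XA X0; rewrite -scalemxAl -scalemxAr scalerA mulmxA.
rewrite mulmxKV ?frakD_unit // -mulmxA -vecS_hadamard -XA.
have [t0|t0] := eqVneq t 0; last by rewrite mulVf // scale1r.
by rewrite X0 // -[0](scale0r 0) vecSZ scale0r mulmx0 scaler0.
Qed.

(** * Assembling the blocks into J u = R *)

Definition dsp_vec (R : realType) (n m p : nat) (w : weights R)
    (d : dsp R n m p) :=
  col_mx
   (col_mx (th1 w *: vec (bA d))
   (col_mx (th2 w *: vec (bB d))
   (col_mx (th4 w *: (frakD R m *m vecS (bC d)))
   (col_mx (th5 w *: vec (bD1 d))
   (col_mx (th6 w *: vec (bD2 d))
           (th7 w *: (frakD R p *m vecS (bE d))))))))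
   (col_mx (th8 w *: bf d) (col_mx (th9 w *: bg d) (th10 w *: bh d))).

Lemma cost_dsp_vec (R : realType) (n m p : nat) (w : weights R)
    (d : dsp R n m p) : (bC d)^T = bC d -> (bE d)^T = bE d ->
  cost w d = fnorm (dsp_vec w d).
Proof.
move=> Cs Es; rewrite -[RHS]ger0_norm ?fnorm_ge0 // -sqrtr_sqr.
rewrite !fnorm_sqr_col_mx !fnorm_sqrZ !fnorm_vec !fnorm_frakD_vecS //.
by rewrite /cost !addrA.
Qed.

(** Since [d] need not solve the perturbed system here, the identity serves both ways: J u = R holds
    exactly when the perturbed system does. *)
Lemma calJ_dsp_vec (R : realType) (n m p : nat) (w : weights R)
    (P d : dsp R n m p) (x : 'cV[R]_n) (y : 'cV[R]_m) (z : 'cV[R]_p) :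
  th8 w != 0 -> th9 w != 0 -> th10 w != 0 ->
  (bC d)^T = bC d -> (bE d)^T = bE d ->
  sparsity_preserving P d -> zero_weights_unperturbed w d ->
  calJ w P x y z *m dsp_vec w d =
  dsp_mx (dsp_add P d) *m col_mx x (col_mx y z) - dsp_rhs (dsp_add P d)
  + residual P x y z.
Proof.
move=> t8 t9 t10 Cs Es [[sA sB sC] [sD1 sD2 sE]].
move=> [[zA zB zC] [[zD1 zD2 zE] _]].
rewrite /calJ /Jtilde /calI /dsp_vec /dsp_mx /dsp_rhs /residual.
rewrite !(mul_row_col, mul_col_mx, mul0mx, add0r, addr0, scaleNr, mulNmx).
rewrite !mul_block_vec // !mul_block_vecS // !mul_Mmx_vec !mul_Nmx_vec.
rewrite !mul_Kmx_vecS // !mul_scalar_mx !scalerA !mulNr !mulVf // !scaleN1r.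
rewrite !opp_col_mx !add_col_mx.
case: P {sA sB sC sD1 sD2 sE} => A B C D1 D2 E f g h.
case: d Cs Es zA zB zC zD1 zD2 zE => dA dB dC dD1 dD2 dE df dg dh /= *.
rewrite !(mulmxDl, mulNmx, linearD) /=.
congr (col_mx _ (col_mx _ _)); apply/colP => i.
- move: (A *m x) (dA *m x) (B^T *m y) (dB^T *m y) => u1 u2 u3 u4.
  by rewrite !mxE; ring.
- move: (B *m x) (dB *m x) (C *m y) (dC *m y) => u1 u2 u3 u4.
  move: (D1^T *m z) (dD1^T *m z) => u5 u6.
  by rewrite !mxE; ring.
- move: (D2 *m y) (dD2 *m y) (E *m z) (dE *m z) => u1 u2 u3 u4.
  by rewrite !mxE; ring.
Qed.

(** The columns of [calI] suffice: [K] is zero against [Jtilde] and inverts [calI] below. *)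
Lemma calJ_right_inverse (R : realType) (n m p : nat) (w : weights R)
    (P : dsp R n m p) (x : 'cV[R]_n) (y : 'cV[R]_m) (z : 'cV[R]_p) :
  th8 w != 0 -> th9 w != 0 -> th10 w != 0 ->
  exists K, calJ w P x y z *m K = 1%:M.
Proof.
move=> t8 t9 t10.
rewrite /calJ; exists (col_mx 0 (block_mx (- th8 w)%:M 0 0
  (block_mx (- th9 w)%:M 0 0 (- th10 w)%:M))).
have -> : calI n m p w = block_mx (- (th8 w)^-1)%:M 0 0
    (block_mx (- (th9 w)^-1)%:M 0 0 (- (th10 w)^-1)%:M).
  rewrite /calI row_mx0 -(block_mxEv 0 (row_mx _ 0)) block_mxEh col_mx0.
  by rewrite -!block_mxEv.
rewrite mul_row_col mulmx0 add0r !mulmx_block !(mulmx0, mul0mx, addr0, add0r).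
rewrite -!scalar_mxM !mulrNN !mulVf //.
by rewrite -!scalar_mx_block.
Qed.

(** Transposing J turns its masks and inverse weights into the form of [vec_range] and [vecS_range],
    which provide the matrix perturbations block by block. *)
Lemma tr_calJ_range (R : realType) (n m p : nat) (w : weights R)
    (P : dsp R n m p) (x : 'cV[R]_n) (y : 'cV[R]_m) (z : 'cV[R]_p)
    (q : 'cV[R]_(n + (m + p))) :
  th8 w != 0 -> th9 w != 0 -> th10 w != 0 ->
  (bC P)^T = bC P -> (bE P)^T = bE P ->
  exists d : dsp R n m p,
    [/\ (bC d)^T = bC d, (bE d)^T = bE d, sparsity_preserving P d,
        zero_weights_unperturbed w d & dsp_vec w d = (calJ w P x y z)^T *m q].
Proof.
move=> t8 t9 t10 Cs Es.
have [r1 [r2 [r3 ->]]] : exists r1 r2 r3, q = col_mx r1 (col_mx r2 r3).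
  by exists (usubmx q), (usubmx (dsubmx q)), (dsubmx (dsubmx q));
    rewrite !vsubmxK.
have [dA [sA zA eA]] := vec_range (th1 w) (bA P) ((Mmx n x)^T *m r1).
have [dB [sB zB eB]] :=
  vec_range (th2 w) (bB P) ((Nmx n y)^T *m r1 + (Mmx m x)^T *m r2).
have [dC [Cds sC zC eC]] := vecS_range (th4 w) (- (Kmx y)^T *m r2) Cs.
have [dD1 [sD1 zD1 eD1]] := vec_range (th5 w) (bD1 P) ((Nmx m z)^T *m r2).
have [dD2 [sD2 zD2 eD2]] := vec_range (th6 w) (bD2 P) ((Mmx p y)^T *m r3).
have [dE [Eds sE zE eE]] := vecS_range (th7 w) ((Kmx z)^T *m r3) Es.
(* Weighting -t^-2 r by t gives -t^-1 r, the matching block of the transpose of [calI] applied to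
   q. *)
exists (Dsp dA dB dC dD1 dD2 dE (- (th8 w ^- 2) *: r1)
  (- (th9 w ^- 2) *: r2) (- (th10 w ^- 2) *: r3)).
split=> //; first by split=> //; split=> //;
  split=> /eqP; rewrite (negPf t8, negPf t9, negPf t10).
rewrite /calJ /Jtilde /calI /dsp_vec /= eA eB eC eD1 eD2 eE.
rewrite !(tr_row_mx, tr_col_mx, trmx0, mul_row_col, mul_col_mx, add_col_mx).
rewrite !(mul0mx, add0r, addr0, tr_scalar_mx, mul_scalar_mx, scalerA).
rewrite !mulrN !mulr_inv_sqr.
rewrite !linearZ /= !trmx_mul !trmx_inv !tr_diag_mx -!scalemxAl.
rewrite !mulmxA !mulmxDr !mulmxA !scalerDr.
by rewrite mulmxN mulNmx scalerN !scaleNr.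
Qed.


(** The first conjunct makes [invmx] a true inverse, as it returns a singular argument unchanged;
    the second makes the infimum a minimum. *)
Theorem theorem5p1 (R : realType) (n m p : nat)
    (A : 'M[R]_n) (B : 'M[R]_(m, n)) (C : 'M[R]_m)
    (D1 D2 : 'M[R]_(p, m)) (E : 'M[R]_p)
    (f : 'cV[R]_n) (g : 'cV[R]_m) (h : 'cV[R]_p)
    (x : 'cV[R]_n) (y : 'cV[R]_m) (z : 'cV[R]_p)
    (t1 t2 t4 t5 t6 t7 t8 t9 t10 : R)
    (hA : A <> A^T) (hC : C^T = C) (hE : E^T = E) (hD : D1 <> D2)
    (hns : dsp_mx (Dsp A B C D1 D2 E f g h) \in unitmx)
    (ht1 : 0 <= t1) (ht2 : 0 <= t2) (ht4 : 0 <= t4) (ht5 : 0 <= t5)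
    (ht6 : 0 <= t6) (ht7 : 0 <= t7)
    (ht8 : 0 <= t8) (ht9 : 0 <= t9) (ht10 : 0 <= t10)
    (ht8' : t8 <> 0) (ht9' : t9 <> 0) (ht10' : t10 <> 0) :
  let P := Dsp A B C D1 D2 E f g h in
  let w := Weights t1 t2 t4 t5 t6 t7 t8 t9 t10 in
  let J := calJ w P x y z in
  [/\ J *m J^T \in unitmx,
      sps_costs w P x y z (eta_sps w P x y z) &
      eta_sps w P x y z
        = fnorm (J^T *m invmx (J *m J^T) *m residual P x y z)].

Proof.
move=> P w J.
have [w8 w9 w10] : [/\ th8 w != 0, th9 w != 0 & th10 w != 0].
  by split; apply/eqP.
have [K JK] := calJ_right_inverse P x y z w8 w9 w10.
have Junit : J *m J^T \in unitmx := gram_unitmx JK.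
set r := residual P x y z; set c := fnorm _.
have costs_ge d : (S3 P x y z `&` sparsity_preserving P
    `&` zero_weights_unperturbed w)%classic d -> c <= cost w d.
  move=> [[[Cs Es eqd] sd] zd]; rewrite cost_dsp_vec //.
  by apply: fnorm_min_norm => //; rewrite calJ_dsp_vec // eqd subrr add0r.
have costs_c : sps_costs w P x y z c.
  have [d [Cs Es sd zd dE]] :=
    tr_calJ_range (P := P) x y z (invmx (J *m J^T) *m r) w8 w9 w10 hC hE.
  exists d; last by rewrite cost_dsp_vec // dE mulmxA.
  (* Here J u = R by construction, so [calJ_dsp_vec] forces the perturbed system to hold exactly. *)
  split=> //; split=> //; split=> //; apply/eqP; rewrite -subr_eq0; apply/eqP.
  have := calJ_dsp_vec (P := P) x y z w8 w9 w10 Cs Es sd zd.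
  by rewrite dE !mulmxA mulmxV // mul1mx -[LHS]add0r => /addIr <-.
have etaE : eta_sps w P x y z = c.
  (* An attained lower bound is the infimum: membership of [c] gives one inequality, the bound
     [costs_ge] the other. *)
  apply/eqP; rewrite eq_le; apply/andP; split.
    by apply: ge_inf => //; exists c => _ [d dP <-]; exact: costs_ge.
  by apply: lb_le_inf; [exists c | move=> _ [d dP <-]; exact: costs_ge].
by rewrite etaE; split.
Qed.
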